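(* The number of fixed-III-planes in $\mathrm{PG}(8,q)$ is $$\frac{q^3(q^2-1)(q-1)(q^2+q+1)}{q^2+q+1-\mathrm g(q-\mathrm n+1)}.$$ Each fixed-III-plane contains exactly $\mathrm g$ fixed points, $\mathrm g(q-\mathrm n)$ II$_{\vdots}$-points and $q^2+q+1-\mathrm g(q-\mathrm n+1)$ III$_{.:}$-points, and contains exactly $\mathrm g$ fixed-II-lines.
   Context: Let $q>2$ be a prime power, $\mathrm n\in\{-1,0,1\}$ with $q\equiv\mathrm n\pmod 3$, $\mathrm g=\gcd(3,q-1)$. Let $\phi$ be a collineation of $\mathrm{PG}(2,q^3)$ of order 3 fixing pointwise an $\mathbb F_q$-subplane $\mathcal P_{2,q}$. A point $\bar P$ of $\mathrm{PG}(2,q^3)$ has Type I if in $\mathcal P_{2,q}$, Type II if $\bar P,\bar P^\phi,\bar P^{\phi^2}$ are distinct and collinear, Type III if non-collinear. Bose representation: identifying $\mathbb F_{q^3}^3$ with $\mathbb F_q^9$, each point $\bar P$ corresponds to a plane $[\![P]\!]$ of $\mathrm{PG}(8,q)$; a point is an X-point if it lies in $[\![P]\!]$ with $\bar P$ of Type X. $\phi$ induces a projectivity $\sigma$ of $\mathrm{PG}(8,q)$ of order 3 with $[\![P]\!]^\sigma=[\![P^\phi]\!]$. A fixed point is a point fixed by $\sigma$. A II-point $B$ is a II$_{\vdots}$-point if $B,B^\sigma,B^{\sigma^2}$ are collinear; every III-point is called a III$_{.:}$-point. A fixed-II-line is a $\sigma$-fixed line containing a II$_{\vdots}$-point. A fixed-III-plane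 is a $\sigma$-fixed plane containing at least one III-point.
   Formalization: The projectivity σ is additionally required to be induced by a linear map fixing the three vectors of a frame of the subplane; order 3 and [[P]]^σ=[[P^φ]] alone also allow x↦c·x^q with the norm of c a non-cube (q≡1 mod 3), which has no fixed points. *)

(* Defs.v *)
From HB Require Import structures.
From mathcomp Require Import all_boot all_order all_algebra.
Set Implicit Arguments.
Unset Strict Implicit.
Unset Printing Implicit Defensive.
Import GRing.Theory VectorInternalTheory.
Local Open Scope ring_scope.

HB.instance Definition _ (F : finFieldType) (V : vectType F) :=
  [Countable of {vspace V} by <:].
HB.instance Definition _ (F : finFieldType) (V : vectType F) :=
  [Finite of {vspace V} by <:].

(* [k] is the projective dimension, so the vector dimension is [k.+1]. *)
Record flat (F : finFieldType) (V : vectType F) (k : nat) := Flat {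
  flat_space :> {vspace V};
  _ : \dim flat_space == k.+1 }.

HB.instance Definition _ (F : finFieldType) (V : vectType F) (k : nat) :=
  [isSub for @flat_space F V k].
HB.instance Definition _ (F : finFieldType) (V : vectType F) (k : nat) :=
  [Countable of flat V k by <:].
HB.instance Definition _ (F : finFieldType) (V : vectType F) (k : nat) :=
  [Finite of flat V k by <:].

Notation point V := (flat V 0).
Notation line V := (flat V 1).
Notation plane V := (flat V 2).

Definition collinear (F : finFieldType) (V : vectType F)
    (P Q R : {vspace V}) : bool :=
  [exists l : line V, [&& P <= l, Q <= l & R <= l]%VS].

Definition collineation (F : finFieldType) (V : vectType F)
    (phi : point V -> point V) : Prop :=
  bijective phi /\
  forall P Q R, collinear (phi P) (phi Q) (phi R) = collinear P Q R.

Definition has_order3 (T : Type) (phi : T -> T) : Prop :=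
  (forall x, phi (phi (phi x)) = x) /\ (exists x, phi x <> x).

(* The points with coordinates in the subfield [f K], relative to the basis of
   L^3 formed by the rows of [E]; every subplane over [f K] has this form for
   some invertible [E]. *)
Definition subplane (K L : finFieldType) (f : {rmorphism K -> L})
    (E : 'M[L]_3) : {set point 'rV[L]_3} :=
  [set P | [exists a : 'rV[K]_3,
     (a != 0) && (flat_space P == <[map_mx f a *m E]>%VS)]].

Definition type_II (L : finFieldType)
    (phi : point 'rV[L]_3 -> point 'rV[L]_3) (P : point 'rV[L]_3) : bool :=
  uniq [:: P; phi P; phi (phi P)] && collinear P (phi P) (phi (phi P)).

Definition type_III (L : finFieldType)
    (phi : point 'rV[L]_3 -> point 'rV[L]_3) (P : point 'rV[L]_3) : bool :=
  ~~ collinear P (phi P) (phi (phi P)).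

(* L^3 is a K-space through [f]. *)
Definition identification (K L : finFieldType) (f : {rmorphism K -> L})
    (iota : 'rV[L]_3 -> 'rV[K]_9) : Prop :=
  bijective iota /\
  forall (a : K) (u v : 'rV[L]_3),
    iota (f a *: u + v) = a *: iota u + iota v.

(* When [iota] is an identification the image of P is already a K-subspace, of
   dimension [L : K]; the span only packages it as a {vspace}. *)
Definition bose (K L : finFieldType) (iota : 'rV[L]_3 -> 'rV[K]_9)
    (P : point 'rV[L]_3) : {vspace 'rV[K]_9} :=
  <<[seq iota v | v in flat_space P]>>%VS.

(* The first two conditions, [lker sigma == 0] and compatibility with [phi],
   determine the projectivity only up to composition with the maps induced by
   the scalars of L.  The last one selects the linear map which, in the
   coordinates given by [E], is the coordinatewise action of a field
   automorphism of L.  Without it the projectivity could be without fixed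
   points: x |-> c x^q, with the norm of c not a cube in K. *)
Definition induced_by (K L : finFieldType) (iota : 'rV[L]_3 -> 'rV[K]_9)
    (E : 'M[L]_3) (phi : point 'rV[L]_3 -> point 'rV[L]_3)
    (sigma : 'End('rV[K]_9)) : Prop :=
  [/\ lker sigma = 0%VS,
      forall P, (sigma @: bose iota P)%VS = bose iota (phi P)
    & forall i : 'I_3, sigma (iota (row i E)) = iota (row i E)].

Definition fixed (K : finFieldType) (sigma : 'End('rV[K]_9))
    (U : {vspace 'rV[K]_9}) : bool :=
  (sigma @: U)%VS == U.

Definition II_point (K L : finFieldType) (iota : 'rV[L]_3 -> 'rV[K]_9)
    (phi : point 'rV[L]_3 -> point 'rV[L]_3) (B : point 'rV[K]_9) : bool :=
  [exists P, type_II phi P && (B <= bose iota P)%VS].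

Definition III_point (K L : finFieldType) (iota : 'rV[L]_3 -> 'rV[K]_9)
    (phi : point 'rV[L]_3 -> point 'rV[L]_3) (B : point 'rV[K]_9) : bool :=
  [exists P, type_III phi P && (B <= bose iota P)%VS].

Definition II_collinear_point (K L : finFieldType)
    (iota : 'rV[L]_3 -> 'rV[K]_9) (phi : point 'rV[L]_3 -> point 'rV[L]_3)
    (sigma : 'End('rV[K]_9)) (B : point 'rV[K]_9) : bool :=
  II_point iota phi B && collinear B (sigma @: B) (sigma @: (sigma @: B)).

Definition fixed_II_line (K L : finFieldType)
    (iota : 'rV[L]_3 -> 'rV[K]_9) (phi : point 'rV[L]_3 -> point 'rV[L]_3)
    (sigma : 'End('rV[K]_9)) (l : line 'rV[K]_9) : bool :=
  fixed sigma l &&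
  [exists B, II_collinear_point iota phi sigma B && (B <= l)%VS].

Definition fixed_III_plane (K L : finFieldType)
    (iota : 'rV[L]_3 -> 'rV[K]_9) (phi : point 'rV[L]_3 -> point 'rV[L]_3)
    (sigma : 'End('rV[K]_9)) (pi : plane 'rV[K]_9) : bool :=
  fixed sigma pi && [exists B, III_point iota phi B && (B <= pi)%VS].

(* Main.v *)
Require Import Defs.
From HB Require Import structures.
From mathcomp Require Import all_boot all_order all_algebra.
From mathcomp Require Import all_fingroup all_solvable all_field.
From mathcomp Require Import zify ring.
Set Implicit Arguments.
Unset Strict Implicit.
Unset Printing Implicit Defensive.
Import GRing.Theory FinRing.Theory.
Local Open Scope ring_scope.

(** Transported to L^3 by [iota], the map [sigma] is additive, fixes the rows of
    [E] and permutes the L-lines; hence in the coordinates given by [E] it is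
    the coordinatewise action of an automorphism [tau] of L, fixing K, with
    [tau^3 = 1] and [tau <> 1].

    A vector [v] is of Type III iff [v, v^sigma, v^sigma^2] are independent over
    L, and then the only fixed plane through it is their K-span.  The orbit of
    [w = a v + b v^sigma + c v^sigma^2] has the circulant matrix of [(a, b, c)]
    as coordinate matrix, so the type of [w] is read off the rank of a circulant
    over K.  Its determinant [a^3 + b^3 + c^3 - 3 a b c] splits according to
    [q mod 3], the circulants of rank one correspond to the cube roots of unity
    [k] of K, and so do the fixed lines, as the images of [sigma - k].

    For the number of planes, [(1, t, t^2)] is of Type III as soon as
    [tau t <> t]; its products with the invertible 3x3 matrices over K are all
    the vectors of Type III, and each III-point lies on one fixed-III-plane. *)

(** * Cube roots of unity in a finite field *)

Section CubeRoots.
Variable K : finFieldType.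

(** The multiplicative order of [x] divides both 3 and [#|K|.-1]. *)
Lemma cube_root1_trivial (x : K) : coprime 3 #|K|.-1 -> x ^+ 3 = 1 -> x = 1.
Proof.
move=> co x3; have x0 : x != 0.
  by apply: contra_eq_neq x3 => ->; rewrite expr0n eq_sym oner_eq0.
have xq : x ^+ #|K|.-1 = 1.
  apply: (mulfI x0); rewrite -exprS mulr1 prednK ?expf_card //.
  exact: ltnW (finNzRing_gt1 K).
have [m xm m3] := prim_order_exists (isT : 0 < 3)%N x3.
have mq : (m %| #|K|.-1)%N by rewrite (prim_order_dvd xm) xq.
have : (m %| gcdn 3 #|K|.-1)%N by rewrite dvdn_gcd m3.
rewrite (eqP co) dvdn1 => /eqP m1; move: xm; rewrite m1 => x1.
by rewrite -(prim_expr_order x1) expr1.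
Qed.

Lemma cube_root1_nontrivial :
  (3 %| #|K|.-1)%N -> exists2 w : K, w != 1 & w ^+ 3 = 1.
Proof.
move=> d3; have := d3; rewrite -card_finField_unit.
case/Cauchy => // x _ ox; exists (val x).
  rewrite -val_unit1 val_eqE; apply/eqP => x1.
  by move: ox; rewrite x1 order1.
by rewrite -val_unitX -ox expg_order.
Qed.

Lemma cube_root1_sum (w : K) : w != 1 -> w ^+ 3 = 1 -> w ^+ 2 + w + 1 = 0.
Proof.
move=> w1 w3; have : (w - 1) * (w ^+ 2 + w + 1) = 0.
  by transitivity (w ^+ 3 - 1); [ring | rewrite w3 subrr].
by move/eqP; rewrite mulf_eq0 subr_eq0 (negPf w1) => /eqP.
Qed.

(** Both directions are read in the additive group: the order of 1 divides the order of the group,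
    and conversely Cauchy supplies an element of order 3. *)
Lemma natr3_eq0 : (3%:R == 0 :> K) = (3 %| #|K|)%N.
Proof.
apply/eqP/idP => [K3|].
  pose e : K := 1; have := order_dvdG (in_setT e); rewrite cardsT.
  apply: dvdn_trans; have : (#[e]%g %| 3)%N.
    by rewrite order_dvdn zmodXgE; apply/eqP; exact: K3.
  rewrite dvdn_divisors // !inE => /orP[/eqP o1|/eqP->//].
  by have := oner_neq0 K; move/eqP; case; apply/eqP; rewrite -[1]/e -(order_eq1 e) o1.
move=> d3; have [x ox] : exists x : K, #[x]%g = 3%N.
  by move: d3; rewrite -cardsT => /Cauchy[] // x _ ox; exists x.
have x3 : x *+ 3 = 0 by rewrite -zmodXgE -ox; exact: expg_order.
have /eqP : x * 3%:R = 0 by rewrite mulr_natr.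
rewrite mulf_eq0 => /orP[|/eqP//] /eqP x0.
by move: ox; rewrite x0 order1.
Qed.

Lemma card_cube_roots1 :
  #|[set w : K | w ^+ 3 == 1]| = gcdn 3 (#|K| - 1).
Proof.
rewrite subn1; have [d3|nd3] := boolP (3 %| #|K|.-1)%N; last first.
  have co : coprime 3 #|K|.-1 by rewrite prime_coprime.
  rewrite (eqP co) (_ : [set _ | _] = [set 1]) ?cards1 //.
  apply/setP => w; rewrite !inE; apply/eqP/eqP => [|->]; last exact: expr1n.
  exact: cube_root1_trivial.
rewrite (gcdn_idPl d3); have [w w1 w3] := cube_root1_nontrivial d3.
have w20 := cube_root1_sum w1 w3.
have w0 : w != 0 by apply: contra_eq_neq w3 => ->; rewrite expr0n eq_sym oner_eq0.
have w2w : w ^+ 2 != w.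
  by rewrite expr2 -subr_eq0 -{3}[w]mulr1 -mulrBr mulf_neq0 // subr_eq0.
have w21 : w ^+ 2 != 1.
  by apply: contra_neq w1 => w2; rewrite -w3 exprS w2 mulr1.
rewrite (_ : [set _ | _] = 1 |: [set w; w ^+ 2]).
  rewrite cardsU1 cards2 !inE ![1 == _]eq_sym ![w == w ^+ 2]eq_sym.
  by rewrite (negPf w1) (negPf w21) w2w.
apply/setP => z; rewrite !inE -[LHS]subr_eq0.
rewrite -(subr_eq0 z 1) -(subr_eq0 z w) -(subr_eq0 z (w ^+ 2)).
rewrite -!mulf_eq0; congr (_ == 0).
have -> : w ^+ 2 = - w - 1 by rewrite -[LHS]addr0 -(oppr0 _) -w20; ring.
(* The two sides differ by [(z - 1) * (w ^+ 2 + w + 1)]. *)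
by apply/eqP; rewrite -subr_eq0; apply/eqP; rewrite -[RHS](mulr0 (z - 1)) -w20; ring.
Qed.

End CubeRoots.

(** * Counting the triples with nonzero circulant determinant *)

Section CirculantCount.
Variable K : finFieldType.
Local Notation q := #|K|.

(** Given as a polynomial, so that the counts below only need changes of variables; [det_circ_mx]
    identifies it with a determinant. *)
Definition circ_det (t : K * K * K) : K :=
  let: (a, b, c) := t in
  a ^+ 3 + b ^+ 3 + c ^+ 3 - 3%:R * a * b * c.

Lemma card_neq0 : #|[set x : K | x != 0]| = q.-1.
Proof.
rewrite -(cardsT K) (cardsD1 0 [set: K]) in_setT /=; congr #|pred_of_set _|.
by apply/setP => x; rewrite !inE andbT.
Qed.

Lemma card_pair_neq0 : #|[set x : K * K | x != (0, 0)]| = (q ^ 2).-1.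
Proof.
rewrite -mulnn -card_prod -cardsT (cardsD1 (0, 0) [set: K * K]) in_setT /=.
by congr #|pred_of_set _|; apply/setP => x; rewrite !inE andbT.
Qed.

(** In characteristic 3 the determinant is [(a + b + c) ^+ 3]; a shear makes [a + b + c] a
    coordinate, and the other two are free. *)
Lemma card_circ_det_mod0 : (3 %| q)%N ->
  #|[set t | circ_det t != 0]| = (q ^ 2 * q.-1)%N.
Proof.
rewrite -natr3_eq0 => /eqP K3.
pose h (t : K * K * K) := let: (a, b, c) := t in (a, b, a + b + c).
pose h' (t : K * K * K) := let: (a, b, c) := t in (a, b, c - a - b).
have hK : cancel h h' by case=> [[a b] c] /=; congr (_, _, _); ring.
have h'K : cancel h' h by case=> [[a b] c] /=; congr (_, _, _); ring.
rewrite (_ : [set _ | _] = h @^-1: setX [set: K * K] [set x | x != 0]).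
  rewrite on_card_preimset; last by exists h' => ? _; rewrite ?hK ?h'K.
  by rewrite cardsX card_neq0 cardsT card_prod mulnn.
apply/setP => [[[a b] c]]; rewrite !inE /=.
have -> : (a + b + c == 0) = ((a + b + c) ^+ 3 == 0) by rewrite expf_eq0.
congr (_ != 0).
have -> : (a + b + c) ^+ 3 = a ^+ 3 + b ^+ 3 + c ^+ 3 - 3%:R * a * b * c
  + 3%:R * (a ^+ 2 * b + a * b ^+ 2 + b ^+ 2 * c + b * c ^+ 2 + c ^+ 2 * a
   + c * a ^+ 2 + 3%:R * a * b * c) by ring.
by rewrite K3; ring.
Qed.

(** A nontrivial cube root of unity [w] splits the determinant into three linear forms. They are the
    components of the Fourier transform [h] of order 3, invertible because 3 is, so three
    coordinates have to be nonzero. *)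
Lemma card_circ_det_mod1 : (3 %| q.-1)%N ->
  #|[set t | circ_det t != 0]| = (q.-1 ^ 3)%N.
Proof.
move=> d3; have [w w1 w3] := cube_root1_nontrivial d3.
have w20 := cube_root1_sum w1 w3.
have K3 : 3%:R != 0 :> K.
  rewrite natr3_eq0; apply/negP => d3'.
  by move: d3 d3' (finNzRing_gt1 K); move: #|K| => k; lia.
have w2 : w ^+ 2 = - w - 1 by rewrite -[LHS]addr0 -(oppr0 _) -w20; ring.
pose h (t : K * K * K) := let: (a, b, c) := t in
  (a + b + c, a + w * b + w ^+ 2 * c, a + w ^+ 2 * b + w * c).
pose h' (t : K * K * K) := let: (x, y, z) := t in
  ((x + y + z) / 3%:R, (x + w ^+ 2 * y + w * z) / 3%:R,
   (x + w * y + w ^+ 2 * z) / 3%:R).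
have hK : cancel h h'.
  case=> [[a b] c] /=; congr (_, _, _); apply: (mulIf K3);
  rewrite mulfVK //; ring: w2.
have h_bij : bijective h by apply: injF_bij; apply: can_inj hK.
rewrite (_ : [set _ | _] = h @^-1: setX (setX [set x | x != 0] [set x | x != 0])
   [set x | x != 0]).
  rewrite on_card_preimset; last exact: onW_bij.
  by rewrite !cardsX card_neq0 !expnS expn0 muln1 mulnA.
apply/setP => [[[a b] c]]; rewrite !inE /= -!negb_or -!mulf_eq0.
by congr (_ != 0); ring: w2.
Qed.

(** The determinant is [a + b + c] times the quadratic form [d ^+ 2 + d * e + e ^+ 2] in [d = a - b]
    and [e = b - c], which is anisotropic here. *)
Lemma card_circ_det_mod2 : (3 %| q.+1)%N ->
  #|[set t | circ_det t != 0]| = (q.-1 * (q ^ 2).-1)%N.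
Proof.
move=> d3.
have K3 : 3%:R != 0 :> K.
  rewrite natr3_eq0; apply/negP => d3'.
  by move: d3 d3' (finNzRing_gt1 K); move: #|K| => k; lia.
have co : coprime 3 q.-1.
  rewrite prime_coprime //; apply/negP => d3'.
  by move: d3 d3' (finNzRing_gt1 K); move: #|K| => k; lia.
pose h (t : K * K * K) := let: (a, b, c) := t in (a + b + c, (a - b, b - c)).
have h_inj : injective h.
  move=> [[a b] c] [[a' b'] c'] [e1 e2 e3].
  have cc : c = c'.
    apply: (mulfI K3).
    have -> : 3%:R * c = (a + b + c) - (a - b) - 2%:R * (b - c) by ring.
    by rewrite e1 e2 e3; ring.
  move: e3; rewrite cc => /addIr bb; by move: e2; rewrite bb => /addIr ->.
have h_bij : bijective h by apply: inj_card_bij => //; rewrite !card_prod mulnA.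
rewrite (_ : [set _ | _] = h @^-1: setX [set x | x != 0] [set x | x != (0, 0)]).
  rewrite on_card_preimset; last exact: onW_bij.
  by rewrite cardsX card_neq0 card_pair_neq0.
apply/setP => [[[a b] c]]; rewrite !inE /=.
have -> : a ^+ 3 + b ^+ 3 + c ^+ 3 - 3%:R * a * b * c =
  (a + b + c) * ((a - b) ^+ 2 + (a - b) * (b - c) + (b - c) ^+ 2) by ring.
rewrite mulf_eq0 negb_or; congr (_ && ~~ _).
move: (a - b) (b - c) => d e; rewrite -pair_eqE /=.
apply/eqP/andP => [de0|[/eqP-> /eqP->]]; last by ring.
(* If [e] is nonzero, [d / e] is a root of X^2 + X + 1, hence a cube root of unity, hence 1; this
   would give 3 = 0. *)
have [e0|e0] := eqVneq e 0.
  by move: de0; rewrite e0 mulr0 expr0n !addr0 => /eqP; rewrite sqrf_eq0 => ->; split.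
have t0 : (d / e) ^+ 2 + d / e + 1 = 0.
  by apply: (mulIf (expf_neq0 2 e0)); rewrite mul0r -de0; field.
have t1 : d / e = 1.
  apply: cube_root1_trivial => //.
  by apply/eqP; rewrite -subr_eq0 -(mulr0 (d / e - 1)) -t0; apply/eqP; ring.
by move: t0 K3; rewrite t1 => t0; rewrite -t0 -subr_eq0 (_ : _ - _ = 0) ?eqxx //; ring.
Qed.

End CirculantCount.

(** * Points as spans of vectors, collinearity as rank, circulant matrices *)

Section Points.
Variables (F : finFieldType) (n : nat).
Local Notation V := 'rV[F]_n.

Lemma point_vector (B : point V) : exists2 v, v != 0 & flat_space B = <[v]>%VS.
Proof.
have dB : \dim B = 1%N by case: B => U /= /eqP.
have vB : vpick B != 0 by rewrite vpick0 -dimv_eq0 dB.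
exists (vpick B) => //; apply/esym/eqP; rewrite eqEdim -memvE memv_pick.
by rewrite dB dim_vline vB.
Qed.

Lemma vector_point (v : V) : v != 0 -> exists B : point V, flat_space B = <[v]>%VS.
Proof.
by move=> v0; have dv : \dim <[v]> == 1%N; [rewrite dim_vline v0 | exists (Flat dv)].
Qed.

Lemma flat_space_inj (k : nat) : injective (@flat_space F V k).
Proof. exact: val_inj. Qed.

Lemma vline_eq (u v : V) : u != 0 -> u \in <[v]>%VS -> <[u]>%VS = <[v]>%VS.
Proof.
move=> u0 uv; apply/eqP; rewrite eqEdim -memvE uv !dim_vline u0.
by case: (v != 0).
Qed.

Lemma card_vline_neq0 (v : V) : v != 0 ->
  #|[set u : V | (u != 0) && (u \in <[v]>%VS)]| = #|F|.-1.
Proof.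
move=> v0; have v_inj : injective (fun k : F => k *: v).
  move=> a b /eqP; rewrite -subr_eq0 -scalerBl scaler_eq0 (negPf v0) orbF.
  by rewrite subr_eq0 => /eqP.
rewrite -card_neq0 -(card_imset _ v_inj).
apply: eq_card => u; rewrite inE; apply/andP/imsetP.
  case=> u0 /vlineP[k uk]; exists k => //; rewrite inE.
  by apply: contra_neq u0 => k0; rewrite uk k0 scale0r.
case=> k; rewrite inE => k0 ->; split; first by rewrite scaler_eq0 negb_or k0.
by rewrite memvZ ?memv_line.
Qed.

(** Double counting of the pairs of a point and a nonzero vector in it: a point contains [#|F|.-1]
    such vectors, and each of them lies in one point only. *)
Lemma card_points (Q : pred (point V)) (R : pred V) :
  (forall B v, v != 0 -> flat_space B = <[v]>%VS -> Q B = R v) ->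
  (#|[set B | Q B]| * #|F|.-1)%N = #|[set v : V | (v != 0) && R v]|.
Proof.
move=> QR; rewrite -sum_nat_const.
transitivity (\sum_(B in [set B : point V | Q B])
    \sum_(v | (v != 0%R) && (v \in flat_space B)) 1)%N.
  apply: eq_bigr => B _; have [v v0 ->] := point_vector B.
  by rewrite -(card_vline_neq0 v0) sum1dep_card.
have mem_point (B : point V) v : v != 0 -> v \in flat_space B ->
    flat_space B = <[v]>%VS.
  by have [c c0 ->] := point_vector B => v0 vc; rewrite (vline_eq v0 vc).
rewrite (exchange_big_dep (fun v => (v != 0) && R v)) /=.
  rewrite -sum1dep_card; apply: eq_bigr => v /andP[v0 Rv].
  have [B Bv] := vector_point v0.
  rewrite sum1dep_card (_ : [set _ | _] = [set B]) ?cards1 //.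
  apply/setP => C; rewrite !inE v0 /=; apply/andP/eqP => [[_]|->].
    by move/(mem_point _ _ v0) => Cv; apply: flat_space_inj; rewrite Cv Bv.
  by rewrite (QR B v) // Bv memv_line.
move=> B v; rewrite inE => QB /andP[v0 vB]; rewrite v0 /=.
by rewrite -(QR B v) // (mem_point _ _ v0 vB).
Qed.

Definition mx3 (u v w : V) : 'M[F]_(3, n) := \matrix_(i < 3) [:: u; v; w]`_i.

Definition row3 (t : F * F * F) : 'rV[F]_3 := \row_(i < 3) [:: t.1.1; t.1.2; t.2]`_i.

Lemma mul_row3 a b c (u v w : V) :
  row3 (a, b, c) *m mx3 u v w = a *: u + b *: v + c *: w.
Proof.
rewrite mulmx_sum_row !big_ord_recr big_ord0 /= add0r !mxE /=.
by rewrite !rowK.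
Qed.

Lemma row3P (x : 'rV[F]_3) : exists t, x = row3 t.
Proof.
exists (x 0 0, x 0 1, x 0 ord_max).
apply/rowP => i; rewrite mxE; case: i => [[|[|[|//]]] i3] /=;
 by congr (x _ _); apply: val_inj.
Qed.

Lemma row3_inj : injective row3.
Proof.
move=> [[a b] c] [[a' b'] c'] /rowP e.
move: (e 0) (e 1) (e ord_max); rewrite !mxE /= => -> -> -> //.
Qed.

Lemma row3_eq0 t : (row3 t == 0) = (t == (0, 0, 0)).
Proof.
have <- : row3 (0, 0, 0) = 0.
  by apply/rowP => i; rewrite !mxE; case: i => [[|[|[|//]]] i3].
exact: (inj_eq row3_inj).
Qed.

Lemma row_free3P (u v w : V) :
  reflect (forall a b c, a *: u + b *: v + c *: w = 0 -> (a, b, c) = (0, 0, 0))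
          (row_free (mx3 u v w)).
Proof.
apply: (iffP idP) => [fr a b c|fr].
  by rewrite -mul_row3 => /eqP; rewrite mulmx_free_eq0 // row3_eq0 => /eqP.
apply: inj_row_free => x; have [[[a b] c] ->] := row3P x.
by rewrite mul_row3 => /fr/eqP; rewrite -row3_eq0 => /eqP.
Qed.

Lemma free3E (u v w : V) : free [:: u; v; w] = row_free (mx3 u v w).
Proof.
apply/(@freeP _ _ _ [tuple u; v; w])/row_free3P => fr.
  move=> a b c e; have := fr (fun i => [:: a; b; c]`_i).
  rewrite !big_ord_recr big_ord0 /= add0r => /(_ e) k0.
  by have := k0 0; have := k0 1; have := k0 ord_max => /= -> -> ->.
move=> k; rewrite !big_ord_recr big_ord0 /= add0r => /fr[k0 k1 k2] i.
case: i => [[|[|[|//]]] i3]; [rewrite -[RHS]k0|rewrite -[RHS]k1|rewrite -[RHS]k2];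
  by congr (k _); apply: val_inj.
Qed.

(** Vectors outside [U] are adjoined one at a time. Since [collinear] asks for a line, a span of
    dimension less than 2 has to be enlarged. *)
Lemma subv_extend (U : {vspace V}) (k : nat) : (\dim U <= k <= n)%N ->
  exists2 W : {vspace V}, \dim W = k & (U <= W)%VS.
Proof.
have [m] := ubnP (k - \dim U); elim: m => // m IH in U *.
move=> lm /andP[Uk kn]; have [Uk'|nUk] := eqVneq (\dim U) k; first by exists U.
have Uf : ~~ (fullv <= U)%VS.
  apply: contra nUk => /dimvS; rewrite dimvf /dim /= mul1n => nU.
  by rewrite eqn_leq Uk (leq_trans kn nU).
have [w _ wU] := subvPn Uf.
have w0 : w != 0 by apply: contraNneq wU => ->; rewrite mem0v.
have dUw : \dim (U + <[w]>) = (\dim U).+1.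
  rewrite dimv_disjoint_sum ?dim_vline ?w0 ?addn1 //.
  apply/eqP; rewrite -subv0; apply/subvP => x /memv_capP[xU /vlineP[a xa]].
  have [a0|a0] := eqVneq a 0; first by rewrite xa a0 scale0r mem0v.
  by case/negP: wU; rewrite -[w](scalerK a0) -xa memvZ.
have [||W dW UW] := IH (U + <[w]>)%VS; rewrite ?dUw.
- by move/eqP: nUk; lia.
- by move/eqP: nUk; lia.
by exists W => //; apply: subv_trans UW; rewrite addvSl.
Qed.

(** A line has vector dimension 2 and contains no free triple; a dependent triple spans at most that
    much, and [1 < n] leaves room to extend the span to a line. *)
Lemma collinearE (u v w : V) : (1 < n)%N ->
  collinear <[u]> <[v]> <[w]> = ~~ row_free (mx3 u v w).
Proof.
move=> n1; rewrite -free3E; apply/existsP/idP => [[l /and3P[ul vl wl]]|nfr].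
  apply/negP => fr; have : (\dim <<[:: u; v; w]>> <= \dim l)%N.
    by rewrite dimvS // !span_cons span_nil addv0 !subv_add ul vl.
  by rewrite (eqP fr); case: l {ul vl wl} => U /= /eqP ->.
have [|W dW uW] := @subv_extend <<[:: u; v; w]>>%VS 2.
  rewrite n1 andbT; have := dim_span [:: u; v; w].
  by rewrite leq_eqVlt => /predU1P[/eqP fr|//]; case/negP: nfr.
have dW' : \dim W == 2 by rewrite dW.
exists (Flat dW'); move: uW.
by rewrite /= !span_cons span_nil addv0 !subv_add.
Qed.

Definition circ_mx (a b c : F) : 'M[F]_3 :=
  \matrix_(i < 3) [:: row3 (a, b, c); row3 (c, a, b); row3 (b, c, a)]`_i.

Lemma det_circ_mx (a b c : F) : \det (circ_mx a b c) = circ_det (a, b, c).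
Proof.
rewrite (expand_det_row _ ord0) !big_ord_recr big_ord0 /= add0r /cofactor.
rewrite !(expand_det_row _ ord0) !big_ord_recr !big_ord0 /= !add0r /cofactor.
by rewrite !det_mx11 !mxE /= ?mxE /= !expr0 !expr1; ring.
Qed.

(** The new triple is the circulant matrix times the old one, and a row-free right factor preserves
    the rank. *)
Lemma row_free_circ (u v w : V) a b c : row_free (mx3 u v w) ->
  row_free (mx3 (a *: u + b *: v + c *: w) (c *: u + a *: v + b *: w)
                (b *: u + c *: v + a *: w)) = (circ_det (a, b, c) != 0).
Proof.
move=> fr; rewrite (_ : mx3 _ _ _ = circ_mx a b c *m mx3 u v w).
  rewrite /row_free mxrankMfree // -/(row_free (circ_mx a b c)).
  by rewrite row_free_unit unitmxE unitfE det_circ_mx.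
apply/row_matrixP => i; rewrite row_mul !rowK.
by case: i => [[|[|[|//]]] i3] /=; rewrite mul_row3.
Qed.

End Points.

(** * Additive maps that fix the basis and permute the lines are field automorphisms on
    coordinates *)

Section Semilinear.
Variables (L : fieldType) (n : nat) (S : 'rV[L]_n.+2 -> 'rV[L]_n.+2).
Hypothesis S_additive : {morph S : x y / x + y}.
Hypothesis S_delta : forall i, S (delta_mx 0 i) = delta_mx 0 i.
Hypothesis S_line : forall a x, exists k, S (a *: x) = k *: S x.

Local Notation e i := (delta_mx 0 i : 'rV[L]_n.+2).

Let S0 : S 0 = 0.
Proof. by apply: (addrI (S 0)); rewrite -S_additive !addr0. Qed.

Let SB : {morph S : x y / x - y}.
Proof.
move=> x y; apply: (addIr (S y)); rewrite -S_additive.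
by rewrite !subrK.
Qed.

Let T a := S (a *: e 0) 0 0.

(** The image of [a *: (e 0 + e i)] is a multiple of [e 0 + e i], so axis [i] is scaled by the same
    factor as axis 0. *)
Let S_axis a i : S (a *: e i) = T a *: e i.
Proof.
have axis j : exists k, S (a *: e j) = k *: e j.
  by have [k] := S_line a (e j); rewrite S_delta; exists k.
have [k0 E0] := axis 0; have T0 : T a = k0 by rewrite /T E0 !mxE !eqxx mulr1.
have [->|i0] := eqVneq i 0; first by rewrite E0 T0.
have [ki Ei] := axis i; have [k] := S_line a (e 0 + e i).
rewrite scalerDr !S_additive !S_delta E0 Ei T0 => /rowP E1.
have := E1 0; have := E1 i; rewrite !mxE !eqxx /= (negPf i0) eq_sym (negPf i0).
by rewrite ?(mulr0, mulr1, addr0, add0r) => -> <-.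
Qed.

Lemma semilinear_morphism :
  exists tau : {rmorphism L -> L}, forall x, S x = map_mx tau x.
Proof.
have TB : zmod_morphism T.
  by move=> a b; rewrite /T scalerBl SB !mxE.
have TM : monoid_morphism T.
  split=> [|a b]; first by rewrite /T scale1r S_delta mxE !eqxx.
  (* On axis 0 the multiplier [k] is [T a]; axis 1 then reads [T (a * b) = k * T b]. Two axes are
     needed, hence the dimension [n.+2]. *)
  have [k] := S_line a (e 0 + b *: e 1).
  rewrite scalerDr scalerA !S_additive !S_axis S_delta => /rowP E1.
  have := E1 0; have := E1 1; rewrite !mxE !eqxx /=.
  by rewrite ?(mulr0, mulr1, addr0, add0r) => -> ->.
pose tau : {rmorphism L -> L} := HB.pack_for {rmorphism L -> L} T
  (GRing.isZmodMorphism.Build L L T TB) (GRing.isMonoidMorphism.Build L L T TM).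
exists tau => x; rewrite {1}[x]row_sum_delta (big_morph S S_additive S0).
under eq_bigr do rewrite S_axis.
rewrite [RHS]row_sum_delta; apply: eq_bigr => i _; by rewrite mxE.
Qed.

End Semilinear.

(** * The Bose representation and the action of [sigma] on L^3 *)

Section Bose.
Variables (K L : finFieldType) (f : {rmorphism K -> L}) (E : 'M[L]_3).
Variables (phi : point 'rV[L]_3 -> point 'rV[L]_3).
Variables (iota : 'rV[L]_3 -> 'rV[K]_9) (iota' : 'rV[K]_9 -> 'rV[L]_3).
Variable (sigma : 'End('rV[K]_9)).
Hypothesis E_unit : E \in unitmx.
Hypothesis phi_order : has_order3 phi.
Hypothesis iotaK : cancel iota iota'.
Hypothesis iota'K : cancel iota' iota.
Hypothesis iota_lin : forall (a : K) (u v : 'rV[L]_3),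
  iota (f a *: u + v) = a *: iota u + iota v.
Hypothesis sigma_ind : induced_by iota E phi sigma.

Lemma iotaD : {morph iota : u v / u + v}.
Proof. by move=> u v; rewrite -[u]scale1r -(rmorph1 f) iota_lin rmorph1 !scale1r. Qed.

Lemma iota0 : iota 0 = 0.
Proof. by apply: (addrI (iota 0)); rewrite -iotaD !addr0. Qed.

Lemma iotaZ a u : iota (f a *: u) = a *: iota u.
Proof. by rewrite -[X in iota X]addr0 iota_lin iota0 addr0. Qed.

Lemma iota_eq0 v : (iota v == 0) = (v == 0).
Proof. by rewrite -(can_eq iotaK) iota0. Qed.

Lemma iota'D : {morph iota' : u v / u + v}.
Proof. by move=> u v; apply: (can_inj iotaK); rewrite iotaD !iota'K. Qed.

Lemma iota'Z a u : iota' (a *: u) = f a *: iota' u.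
Proof. by apply: (can_inj iotaK); rewrite iotaZ !iota'K. Qed.

Lemma iota'0 : iota' 0 = 0.
Proof. by rewrite -iota0 iotaK. Qed.

(** The span adds no vector: [iota'] turns a K-combination of images of vectors of [P] into a
    combination with coefficients in [f K], which stays in [P]. *)
Lemma mem_bose P v : (iota v \in bose iota P) = (v \in flat_space P).
Proof.
apply/idP/idP => [|vP]; last by apply: memv_span; apply: image_f.
rewrite -{2}[v]iotaK /bose; move: (iota v) => u.
set X := image _ _ => uX; rewrite (coord_span (X := in_tuple X) uX).
rewrite (big_morph iota' iota'D iota'0); apply: memv_suml => i _.
rewrite iota'Z memvZ //; have /imageP[w wP ->] : (in_tuple X)`_i \in X.
  by apply: mem_nth.
by rewrite iotaK.
Qed.

(* [sigma] seen on L^3. *)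
Definition twist v := iota' (sigma (iota v)).
Local Notation s := twist.

Lemma sigma_iota v : sigma (iota v) = iota (s v).
Proof. by rewrite iota'K. Qed.

Lemma twistD : {morph s : u v / u + v}.
Proof. by move=> u v; rewrite /twist iotaD linearD iota'D. Qed.

Lemma twistZ a v : s (f a *: v) = f a *: s v.
Proof. by rewrite /twist iotaZ linearZ iota'Z. Qed.

Lemma twist_eq0 v : (s v == 0) = (v == 0).
Proof.
have [ks _ _] := sigma_ind; rewrite -iota_eq0 -sigma_iota -(iota_eq0 v).
have /lker0P s_inj : lker sigma == 0%VS by rewrite ks.
by rewrite -{1}(linear0 sigma) (inj_eq s_inj).
Qed.

(** The link between [phi] and [s]: as [sigma] carries [bose iota P] to [bose iota (phi P)], the
    nonzero vector [s v] lies in the point [phi P]. *)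
Lemma phi_vline (P : point 'rV[L]_3) v : v != 0 ->
  flat_space P = <[v]>%VS -> flat_space (phi P) = <[s v]>%VS.
Proof.
move=> v0 Pv; have [_ sP _] := sigma_ind.
have : s v \in flat_space (phi P).
  by rewrite -mem_bose -sP -sigma_iota memv_img // mem_bose Pv memv_line.
have [c c0 ->] := point_vector (phi P) => sc.
by rewrite -(vline_eq _ sc) ?twist_eq0.
Qed.

(** For nonzero [a] and [v], both [v] and [a *: v] span the same point, whose image under [phi] is
    spanned by either image vector. *)
Lemma twist_line a v : exists k, s (a *: v) = k *: s v.
Proof.
have [->|v0] := eqVneq v 0; first by exists 1; rewrite scaler0 scale1r.
have [->|a0] := eqVneq a 0.
  by exists 0; rewrite !scale0r; apply/eqP; rewrite twist_eq0.
have [P Pv] := vector_point v0.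
have Pav : flat_space P = <[a *: v]>%VS.
  rewrite Pv; apply/esym/vline_eq; first by rewrite scaler_eq0 negb_or a0.
  by rewrite memvZ ?memv_line.
apply/vlineP; rewrite -(phi_vline v0 Pv) (phi_vline _ Pav) ?memv_line //.
by rewrite scaler_eq0 negb_or a0.
Qed.

(** The order of [phi] gives the cube of [s] only up to a scalar; [twist3] removes the scalar once
    coordinates are available. *)
Lemma twist3_line v : s (s (s v)) \in <[v]>%VS.
Proof.
have [->|v0] := eqVneq v 0.
  rewrite (_ : s _ = 0) ?mem0v //; apply/eqP.
  by rewrite !twist_eq0.
have [phi3 _] := phi_order; have [P Pv] := vector_point v0.
have s0 : s v != 0 by rewrite twist_eq0.
have ss0 : s (s v) != 0 by rewrite twist_eq0.
have := phi_vline ss0 (phi_vline s0 (phi_vline v0 Pv)).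
by rewrite phi3 Pv => ->; rewrite memv_line.
Qed.

Lemma twist_coordinates : exists tau : {rmorphism L -> L},
  [/\ forall x, s (x *m E) = map_mx tau x *m E,
      forall a, tau (f a) = f a,
      forall b, tau (tau (tau b)) = b
    & exists b, tau b != b].
Proof.
pose S x := s (x *m E) *m invmx E.
have [|||tau Stau] := @semilinear_morphism L 1 S.
- by move=> x y; rewrite /S mulmxDl twistD mulmxDl.
- move=> i; have [_ _ sE] := sigma_ind.
  by rewrite /S -rowE /twist sE iotaK rowE mulmxK.
- move=> a x; rewrite /S -scalemxAl; have [k ->] := twist_line a (x *m E).
  by exists k; rewrite scalemxAl.
have sE x : s (x *m E) = map_mx tau x *m E by rewrite -Stau /S mulmxKV.
exists tau; split => //.
- move=> a; have : S (f a *: delta_mx 0 0) = f a *: S (delta_mx 0 0).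
    by rewrite /S -scalemxAl twistZ scalemxAl.
  by rewrite !Stau => /rowP/(_ 0); rewrite !mxE !eqxx /= !mulr1 rmorph1 mulr1.
(* The coordinate 1 of [x] forces the scalar of [twist3_line] to be 1, and the coordinate [b] then
   gives the claim. *)
- move=> b; pose x : 'rV[L]_3 := delta_mx 0 0 + b *: delta_mx 0 1.
  have /vlineP[k] := twist3_line (x *m E).
  rewrite !sE scalemxAl => /(can_inj (mulmxK E_unit))/rowP x3.
  have := x3 0; have := x3 1; rewrite !mxE !eqxx /=.
  rewrite !(mulr0, mulr1, addr0, add0r, rmorph1) => ->.
  by move=> <-; rewrite mul1r.
(* If [tau] were the identity, so would be [s], and [phi] would fix every point. *)
have [_ [P phiP]] := phi_order; apply/existsP; apply: contra_notT phiP.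
rewrite negb_exists => /forallP tau1; have [v v0 Pv] := point_vector P.
apply: flat_space_inj; rewrite (phi_vline v0 Pv) Pv; congr <[_]>%VS.
rewrite -{1}[v](mulmxKV E_unit) sE -[RHS](mulmxKV E_unit); congr (_ *m _).
apply/rowP => i; rewrite mxE; apply/eqP.
by move: (tau1 ((v *m invmx E) 0 i)); rewrite negbK.
Qed.

Lemma twist3 v : s (s (s v)) = v.
Proof.
have [tau [sE _ tau3 _]] := twist_coordinates.
rewrite -[v](mulmxKV E_unit) !sE; congr (_ *m _).
by apply/rowP => i; rewrite !mxE tau3.
Qed.

Definition typeIII_vector v := row_free (mx3 v (s v) (s (s v))).

(** The spread property: a nonzero vector lies in the Bose space of one point only, so the
    existential has a single candidate. *)
Lemma exists_bose (Q : pred (point 'rV[L]_3)) (B : point 'rV[K]_9) v P :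
  v != 0 -> flat_space B = <[iota v]>%VS -> flat_space P = <[v]>%VS ->
  [exists P, Q P && (B <= bose iota P)%VS] = Q P.
Proof.
move=> v0 Bv Pv; apply/existsP/idP => [[P' /andP[QP']]|QP].
  rewrite Bv -memvE mem_bose; have [c c0 P'c] := point_vector P'.
  rewrite P'c => vc; suff -> : P = P' by [].
  by apply: flat_space_inj; rewrite P'c Pv (vline_eq v0 vc).
by exists P; rewrite QP Bv -memvE mem_bose Pv memv_line.
Qed.

Lemma phi_collinearE (P : point 'rV[L]_3) v : v != 0 ->
  flat_space P = <[v]>%VS ->
  collinear P (phi P) (phi (phi P)) = ~~ typeIII_vector v.
Proof.
move=> v0 Pv; have s0 : s v != 0 by rewrite twist_eq0.
by rewrite (phi_vline s0 (phi_vline v0 Pv)) (phi_vline v0 Pv) Pv collinearE.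
Qed.

Lemma III_pointE (B : point 'rV[K]_9) v :
  v != 0 -> flat_space B = <[iota v]>%VS ->
  III_point iota phi B = typeIII_vector v.
Proof.
move=> v0 Bv; have [P Pv] := vector_point v0.
rewrite /III_point (exists_bose (type_III phi) v0 Bv Pv).
by rewrite /type_III (phi_collinearE v0 Pv) negbK.
Qed.

(** Since [phi] is injective with cube the identity, [P] and its two images are pairwise distinct as
    soon as [phi P] differs from [P]. *)
Lemma II_pointE (B : point 'rV[K]_9) v :
  v != 0 -> flat_space B = <[iota v]>%VS ->
  II_point iota phi B = (s v \notin <[v]>%VS) && ~~ typeIII_vector v.
Proof.
move=> v0 Bv; have [P Pv] := vector_point v0.
rewrite /II_point (exists_bose (type_II phi) v0 Bv Pv).
rewrite /type_II (phi_collinearE v0 Pv); congr (_ && _).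
have [phi3 _] := phi_order.
have phi_inj : injective phi by apply: (can_inj (g := phi \o phi)) => x; apply: phi3.
have PsP : (P == phi P) = (s v \in <[v]>%VS).
  rewrite -(inj_eq (@flat_space_inj _ _ _)) Pv (phi_vline v0 Pv).
  apply/eqP/idP => [->|sv]; first exact: memv_line.
  by apply/esym/vline_eq; rewrite ?twist_eq0.
rewrite /= !inE andbT (inj_eq phi_inj) PsP.
have -> : (P == phi (phi P)) = (s v \in <[v]>%VS).
  by rewrite -(inj_eq phi_inj) phi3 eq_sym.
by rewrite orbb andbb.
Qed.

Definition comb v (t : K * K * K) :=
  f t.1.1 *: v + f t.1.2 *: s v + f t.2 *: s (s v).

Lemma twist_comb v a b c : s (comb v (a, b, c)) = comb v (c, a, b).
Proof. by rewrite /comb /= !twistD !twistZ twist3 addrC addrA. Qed.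

Lemma combZ v k a b c : f k *: comb v (a, b, c) = comb v (k * a, k * b, k * c).
Proof. by rewrite /comb /= !scalerDr !scalerA !rmorphM. Qed.

Lemma combD v a b c a' b' c' :
  comb v (a, b, c) + comb v (a', b', c') = comb v (a + a', b + b', c + c').
Proof.
rewrite /comb /= !rmorphD !scalerDl.
by rewrite addrACA; congr (_ + _); rewrite addrACA.
Qed.

(** * The fixed plane through a vector of Type III: its points and its lines *)

Section Plane.
Variable v : 'rV[L]_3.
Hypothesis v_III : typeIII_vector v.

Definition orbit_plane : {vspace 'rV[K]_9} :=
  <<[:: iota v; iota (s v); iota (s (s v))]>>%VS.

Lemma iota_comb t :
  iota (comb v t) = t.1.1 *: iota v + t.1.2 *: iota (s v) + t.2 *: iota (s (s v)).
Proof. by rewrite !iotaD !iotaZ. Qed.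

Lemma comb_eq0 t : comb v t = 0 -> t = (0, 0, 0).
Proof.
case: t => [[a b] c] /(row_free3P _ _ _ v_III)[/eqP + /eqP + /eqP].
by rewrite !fmorph_eq0 => /eqP-> /eqP-> /eqP->.
Qed.

Lemma comb_neq0 t : t != (0, 0, 0) -> comb v t != 0.
Proof. by apply: contra_neq; apply: comb_eq0. Qed.

Lemma comb_inj : injective (comb v).
Proof.
move=> [[a b] c] [[a' b'] c'] e.
have /comb_eq0[/eqP + /eqP + /eqP] : comb v (a - a', b - b', c - c') = 0.
  apply: (addIr (comb v (a', b', c'))); rewrite combD !subrK e.
  by rewrite add0r.
by rewrite !subr_eq0 => /eqP-> /eqP-> /eqP->.
Qed.

Lemma iota_free : row_free (mx3 (iota v) (iota (s v)) (iota (s (s v)))).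
Proof.
apply/row_free3P => a b c; rewrite -(iota_comb (a, b, c)) => /eqP.
by rewrite iota_eq0 => /eqP/comb_eq0.
Qed.

Lemma dim_orbit_plane : \dim orbit_plane = 3.
Proof. by apply/eqP; rewrite -/(free _) free3E iota_free. Qed.

Lemma mem_orbit_plane u :
  reflect (exists t, u = iota (comb v t)) (u \in orbit_plane).
Proof.
apply: (iffP idP) => [|[t ->]].
  case/(@coord_span _ _ 3 [tuple _; _; _]); set k := coord _ => ->.
  rewrite !big_ord_recr big_ord0 /= add0r.
  by eexists (_, _, _); rewrite iota_comb.
by rewrite iota_comb !memvD ?memvZ ?memv_span // !inE eqxx ?orbT.
Qed.

Lemma sigma_orbit_plane : (sigma @: orbit_plane)%VS = orbit_plane.
Proof.
rewrite /orbit_plane limg_span /= !sigma_iota twist3.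
by apply: eq_span => x; rewrite !inE orbA orbC.
Qed.

(** By [twist_comb] the orbit has a circulant coordinate matrix with entries in [f K]; as [f] is
    injective, its determinant may be tested in K. *)
Lemma III_vector_comb a b c :
  typeIII_vector (comb v (a, b, c)) = (circ_det (a, b, c) != 0).
Proof.
rewrite /typeIII_vector !twist_comb row_free_circ // -(fmorph_eq0 f).
by rewrite /circ_det !rmorphB !rmorphD !rmorphXn !rmorphM rmorph_nat.
Qed.

(** The same circulant decides independence over K, so within the plane orbits are independent over
    K exactly when they are over L. *)
Lemma iota_free_comb a b c (w := comb v (a, b, c)) :
  row_free (mx3 (iota w) (iota (s w)) (iota (s (s w)))) = (circ_det (a, b, c) != 0).
Proof. by rewrite /w !twist_comb !iota_comb row_free_circ //; apply: iota_free. Qed.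

(* [comb v t] is an eigenvector of [sigma] with eigenvalue in K. *)
Definition eigen_triple (t : K * K * K) :=
  [exists k : K, (t.2, t.1.1, t.1.2) == (k * t.1.1, k * t.1.2, k * t.2)].

(* The scalar is a priori in L; comparing coordinates forces it into K. *)
Lemma twist_comb_line a b c : (a, b, c) != (0, 0, 0) ->
  (s (comb v (a, b, c)) \in <[comb v (a, b, c)]>%VS) = eigen_triple (a, b, c).
Proof.
move=> t0; rewrite twist_comb; apply/vlineP/existsP => [[l]|[k /eqP/= tk]]; last first.
  by exists (f k); rewrite combZ tk.
move=> e; have : (f c - l * f a, f a - l * f b, f b - l * f c) = (0, 0, 0).
  apply: (row_free3P _ _ _ v_III); rewrite !scalerBl -!scalerA.
  move/eqP: e; rewrite -subr_eq0 /comb /= !scalerDr => /eqP <-.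
  by rewrite !opprD [RHS]addrACA; congr (_ + _); rewrite [RHS]addrACA.
case=> /eqP + /eqP + /eqP; rewrite !subr_eq0 => /eqP E1 /eqP E2 /eqP E3.
suff [k lk] : exists k, l = f k.
  exists k; rewrite /= -!pair_eqE /= /pair_eq /=; move: E1 E2 E3; rewrite lk -!rmorphM.
  by move=> /fmorph_inj <- /fmorph_inj <- /fmorph_inj <-; rewrite !eqxx.
have [a0|a0] := eqVneq a 0; last first.
  by exists (c / a); rewrite fmorph_div E1 mulfK // fmorph_eq0.
move: E1; rewrite a0 rmorph0 mulr0 => /eqP; rewrite fmorph_eq0 => /eqP c0.
move: E3; rewrite c0 rmorph0 mulr0 => /eqP; rewrite fmorph_eq0 => /eqP b0.
by move: t0; rewrite a0 b0 c0 eqxx.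
Qed.

(** Following the shift once round the three coordinates multiplies [a] by [k ^+ 3], and [a]
    determines the other two. *)
Lemma eigen_tripleP (a b c k : K) : (c, a, b) = (k * a, k * b, k * c) ->
  (a, b, c) != (0, 0, 0) ->
  [/\ a != 0, k ^+ 3 = 1 & (a, b, c) = (a, k ^+ 2 * a, k * a)].
Proof.
case=> E1 E2 E3 t0.
have bE : b = k ^+ 2 * a by rewrite E3 E1 mulrA.
have aE : a = k ^+ 3 * a by rewrite {1}E2 bE mulrA.
have a0 : a != 0 by apply: contra_neq t0 => a0; rewrite bE E1 a0 !mulr0.
split=> //; first by apply: (mulIf a0); rewrite mul1r -aE.
by rewrite -bE -E1.
Qed.

Lemma fixed_comb a b c (B : point 'rV[K]_9) : (a, b, c) != (0, 0, 0) ->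
  flat_space B = <[iota (comb v (a, b, c))]>%VS ->
  fixed sigma B = eigen_triple (a, b, c).
Proof.
move=> t0 Bw; rewrite /fixed Bw limg_line sigma_iota twist_comb.
apply/eqP/existsP => [e|[k /eqP/= tk]].
  have /vlineP[k] : iota (comb v (c, a, b)) \in <[iota (comb v (a, b, c))]>%VS.
    by rewrite -e memv_line.
  by rewrite -iotaZ combZ => /(can_inj iotaK)/comb_inj tk; exists k; apply/eqP.
apply: vline_eq; last by rewrite tk -combZ iotaZ memvZ ?memv_line.
rewrite iota_eq0 comb_neq0 //; apply: contra_neq t0 => -[-> -> ->] //.
Qed.

Lemma III_point_comb a b c (B : point 'rV[K]_9) : (a, b, c) != (0, 0, 0) ->
  flat_space B = <[iota (comb v (a, b, c))]>%VS ->
  III_point iota phi B = (circ_det (a, b, c) != 0).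
Proof. by move=> t0 Bw; rewrite (III_pointE (comb_neq0 t0) Bw) III_vector_comb. Qed.

(** Not being of Type III and having a collinear orbit are the vanishing of one determinant, so
    every II-point of the plane has a collinear orbit. *)
Lemma II_collinear_comb a b c (B : point 'rV[K]_9) : (a, b, c) != (0, 0, 0) ->
  flat_space B = <[iota (comb v (a, b, c))]>%VS ->
  II_collinear_point iota phi sigma B =
  ~~ eigen_triple (a, b, c) && (circ_det (a, b, c) == 0).
Proof.
move=> t0 Bw; rewrite /II_collinear_point (II_pointE (comb_neq0 t0) Bw).
rewrite III_vector_comb negbK twist_comb_line // Bw !limg_line !sigma_iota.
by rewrite collinearE // iota_free_comb negbK -andbA andbb.
Qed.

(** Using [k ^+ 3 * a = a], each of the cubes and the product [a * b * c] become [a ^+ 3], and 1 + 1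
    + 1 - 3 = 0. *)
Lemma circ_det_eigen t : eigen_triple t -> circ_det t = 0.
Proof.
case: t => [[a b] c] /existsP[k /eqP/= [E1 E2 E3]].
have bE : b = k ^+ 2 * a by rewrite E3 E1 mulrA.
have aE : k ^+ 3 * a = a by rewrite [RHS]E2 bE mulrA.
rewrite /circ_det.
have -> : c ^+ 3 = k ^+ 3 * a * a ^+ 2 by rewrite E1; ring.
have -> : b ^+ 3 = k ^+ 3 * (k ^+ 3 * a) * a ^+ 2 by rewrite bE; ring.
have -> : 3%:R * a * b * c = 3%:R * (k ^+ 3 * a) * a ^+ 2 by rewrite bE E1; ring.
by rewrite !aE; ring.
Qed.

(** This is [card_points] in the coordinates that [comb v] provides on the plane; all point counts
    in the plane become counts of triples. *)
Lemma card_plane_points (Q : pred (point 'rV[K]_9)) (R : pred (K * K * K)) :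
  (forall B a b c, (a, b, c) != (0, 0, 0) ->
     flat_space B = <[iota (comb v (a, b, c))]>%VS -> Q B = R (a, b, c)) ->
  (#|[set B : point 'rV[K]_9 | (B <= orbit_plane)%VS & Q B]| * #|K|.-1)%N =
  #|[set t | (t != (0, 0, 0)) && R t]|.
Proof.
move=> QR.
pose R' u := [exists t, (u == iota (comb v t)) && R t].
rewrite (card_points (R := R')); last first.
  move=> B u u0 Bu; rewrite Bu -memvE.
  apply/andP/existsP => [[/mem_orbit_plane[[[a b] c] ut] QB]|].
    exists (a, b, c); rewrite ut eqxx -(QR B) // -?ut //.
    by apply: contra_neq u0 => t0; rewrite ut t0 iota_comb !scale0r !addr0.
  case=> [[[a b] c] /andP[/eqP ut Rt]]; split.
    by apply/mem_orbit_plane; exists (a, b, c).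
  rewrite (QR B a b c) -?ut //.
  by apply: contra_neq u0 => t0; rewrite ut t0 iota_comb !scale0r !addr0.
have h_inj : injective (iota \o comb v) by apply: inj_comp (can_inj iotaK) comb_inj.
rewrite -(card_imset _ h_inj); apply: eq_card => u; rewrite inE.
apply/andP/imsetP => [[u0 /existsP[t /andP[/eqP ut Rt]]]|[t]].
  exists t => //; rewrite inE Rt andbT.
  by apply: contra_neq u0 => t0; rewrite ut t0 iota_comb !scale0r !addr0.
rewrite inE => /andP[t0 Rt] -> /=; rewrite iota_eq0 comb_neq0 //; split=> //.
by apply/existsP; exists t; rewrite eqxx.
Qed.

Lemma card_plane_fixed :
  #|[set B : point 'rV[K]_9 | (B <= orbit_plane)%VS & fixed sigma B]| =
  gcdn 3 (#|K| - 1).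
Proof.
have q1 : (0 < #|K|.-1)%N by have := finNzRing_gt1 K; case: #|K| => // -[].
apply/eqP; rewrite -(eqn_pmul2r q1) -card_cube_roots1; apply/eqP.
rewrite (card_plane_points (R := eigen_triple)); last first.
  by move=> B a b c t0 Bw; apply: fixed_comb.
rewrite -card_neq0 -cardsX.
(* By [eigen_tripleP], an eigenvalue and a nonzero first coordinate parametrize the nonzero eigen
   triples. *)
pose h (x : K * K) := (x.2, x.1 ^+ 2 * x.2, x.1 * x.2).
rewrite -(card_in_imset (f := h)); last first.
  move=> [k a] [k' a']; rewrite !inE /= => /andP[_ a0] _ [aa _].
  by rewrite -aa => /(mulIf a0) ->.
apply: eq_card => -[[a b] c]; rewrite inE; apply/andP/imsetP.
  case=> t0 /existsP[k /eqP/= tk].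
  have [a0 k3 ->] := eigen_tripleP tk t0.
  by exists (k, a) => //; rewrite !inE k3 eqxx a0.
case=> [[k x]]; rewrite !inE /= => /andP[/eqP k3 x0] [-> -> ->]; split.
  by apply: contra_neq x0 => -[].
apply/existsP; exists k; apply/eqP => /=; congr (_, _, _); last by rewrite mulrA.
by rewrite mulrA -exprS k3 mul1r.
Qed.

Lemma card_triples_neq0 : #|[set t : K * K * K | t != (0, 0, 0)]| = (#|K| ^ 3).-1.
Proof.
have -> : (#|K| ^ 3)%N = #|[set: K * K * K]|.
  by rewrite cardsT !card_prod !expnS expn0 muln1 mulnA.
rewrite (cardsD1 (0, 0, 0) [set: K * K * K]) in_setT /=; congr #|pred_of_set _|.
by apply/setP => x; rewrite !inE andbT.
Qed.

Lemma card_plane_total :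
  (#|[set B : point 'rV[K]_9 | (B <= orbit_plane)%VS]| * #|K|.-1)%N = (#|K| ^ 3).-1.
Proof.
rewrite -card_triples_neq0.
transitivity (#|[set B : point 'rV[K]_9 | (B <= orbit_plane)%VS & true]| * #|K|.-1)%N.
  by congr (_ * _)%N; apply: eq_card => B; rewrite !inE andbT.
rewrite (card_plane_points (R := xpredT)) //.
by apply: eq_card => B; rewrite !inE andbT.
Qed.

Lemma card_plane_III :
  (#|[set B : point 'rV[K]_9 | (B <= orbit_plane)%VS & III_point iota phi B]|
    * #|K|.-1)%N = #|[set t : K * K * K | circ_det t != 0]|.
Proof.
rewrite (card_plane_points (R := fun t => circ_det t != 0)); last first.
  by move=> B a b c t0 Bw; apply: III_point_comb.
apply: eq_card => t; rewrite !inE andb_idl //; apply: contra_neq => ->.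
by rewrite /circ_det; ring.
Qed.

(** Fixed points have determinant zero by [circ_det_eigen], so every point of the plane is of
    exactly one of the three kinds. The II-points get counted by subtraction. *)
Lemma card_plane_partition :
  (#|[set B : point 'rV[K]_9 | (B <= orbit_plane)%VS & III_point iota phi B]| +
   #|[set B : point 'rV[K]_9 | (B <= orbit_plane)%VS &
        II_collinear_point iota phi sigma B]| +
   #|[set B : point 'rV[K]_9 | (B <= orbit_plane)%VS & fixed sigma B]|)%N =
  #|[set B : point 'rV[K]_9 | (B <= orbit_plane)%VS]|.
Proof.
rewrite -!sum1dep_card !big_mkcondr /= -!big_split /= [RHS]big_mkcond /=.
rewrite [LHS]big_mkcond /=; apply: eq_bigr => B _; case: ifP => // BP.
have [u u0 Bu] := point_vector B.
have : u \in orbit_plane by rewrite memvE -Bu.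
case/mem_orbit_plane => [[[a b] c] ut].
have t0 : (a, b, c) != (0, 0, 0).
  by apply: contra_neq u0 => t0; rewrite ut t0 iota_comb !scale0r !addr0.
rewrite ut in Bu; rewrite (III_point_comb t0 Bu) (II_collinear_comb t0 Bu).
rewrite (fixed_comb t0 Bu); case: (boolP (eigen_triple _)) => [/circ_det_eigen ->|_].
  by rewrite eqxx.
by case: (_ == 0).
Qed.

(** An image rather than a span of eigenvectors: it is a line for every cube root of unity [k], even
    when [sigma] has a single fixed point in the plane. *)
Definition eigenimage (k : K) : {vspace 'rV[K]_9} :=
  ((sigma - k *: \1%VF) @: orbit_plane)%VS.

Lemma mem_eigenimage k u :
  reflect (exists2 y, y \in orbit_plane & u = sigma y - k *: y) (u \in eigenimage k).
Proof.
apply: (iffP memv_imgP) => -[y yP ->]; exists y => //;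
  by rewrite !lfunE /= !lfunE /= !lfunE /= id_lfunE.
Qed.

Lemma sigma_plane_mem y : y \in orbit_plane -> sigma y \in orbit_plane.
Proof. by move=> yP; rewrite -sigma_orbit_plane memv_img. Qed.

(** Eigenspaces of [sigma] in the plane have dimension at most 1: the first coordinate determines
    the triple. *)
Lemma eigenvector_line k u : u \in orbit_plane -> sigma u = k *: u ->
  u \in <[iota (comb v (1, k ^+ 2, k)%R)]>%VS.
Proof.
case/mem_orbit_plane=> [[[a b] c] ->].
rewrite sigma_iota -iotaZ combZ twist_comb => /(can_inj iotaK)/comb_inj tk.
have [t0|t0] := eqVneq (a, b, c) (0, 0, 0).
  by rewrite t0 iota_comb !scale0r !addr0 mem0v.
have [_ _ ->] := eigen_tripleP tk t0.
rewrite -[X in (X, _, _)]mulr1 ![_ * a]mulrC -combZ iotaZ.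
by rewrite memvZ ?memv_line.
Qed.

(** Rank-nullity: the kernel of [sigma - k] on the plane is the line of vectors spanned by [e]. *)
Lemma dim_eigenimage k : k ^+ 3 = 1 -> \dim (eigenimage k) = 2.
Proof.
move=> k3; have := limg_ker_dim (sigma - k *: \1%VF) orbit_plane.
rewrite dim_orbit_plane -/(eigenimage k).
pose e := iota (comb v (1, k ^+ 2, k)).
suff -> : (orbit_plane :&: lker (sigma - k *: \1%VF))%VS = <[e]>%VS.
  rewrite dim_vline iota_eq0 comb_neq0 //; last first.
    by apply/eqP => -[/eqP]; rewrite oner_eq0.
  by case.
apply/eqP; rewrite eqEsubv; apply/andP; split; apply/subvP => y.
  case/memv_capP => yP; rewrite memv_ker !lfunE /= !lfunE /= !lfunE /= id_lfunE.
  by rewrite subr_eq0 => /eqP; apply: eigenvector_line.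
case/vlineP => x ->; rewrite memvZ // memv_cap; apply/andP; split.
  by apply/mem_orbit_plane; exists (1, k ^+ 2, k).
rewrite memv_ker !lfunE /= !lfunE /= !lfunE /= id_lfunE subr_eq0 sigma_iota.
by rewrite -iotaZ combZ twist_comb mulr1 -exprS k3 -expr2.
Qed.

Lemma eigenimage_sub k : (eigenimage k <= orbit_plane)%VS.
Proof.
apply/subvP => u /mem_eigenimage[y yP ->].
by rewrite memvB ?memvZ // sigma_plane_mem.
Qed.

Lemma fixed_of_stable (U : {vspace 'rV[K]_9}) :
  (forall y, y \in U -> sigma y \in U) -> fixed sigma U.
Proof.
move=> sU; rewrite /fixed eqEdim limg_dim_eq ?leqnn ?andbT.
  by apply/subvP => _ /memv_imgP[y yU ->]; apply: sU.
by have [-> _ _] := sigma_ind; rewrite capv0.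
Qed.

Lemma fixed_eigenimage k : fixed sigma (eigenimage k).
Proof.
apply: fixed_of_stable => _ /mem_eigenimage[y yP ->].
apply/mem_eigenimage; exists (sigma y); first exact: sigma_plane_mem.
by rewrite linearB linearZ.
Qed.

(** If the images for distinct [k] and [k'] agreed, they would contain every [(k' - k) *: y], that
    is, the whole plane. *)
Lemma eigenimage_inj : {in [set k : K | k ^+ 3 == 1] &, injective eigenimage}.
Proof.
move=> k k'; rewrite !inE => /eqP k3 /eqP k3' kk.
apply/eqP/negPn/negP => nkk.
have : (\dim orbit_plane <= \dim (eigenimage k))%N.
  apply/dimvS/subvP => y yP; have nk : k' - k != 0 by rewrite subr_eq0 eq_sym.
  rewrite -[y](scalerK nk) memvZ //.
  have -> : (k' - k) *: y = (sigma y - k *: y) - (sigma y - k' *: y).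
    by rewrite scalerBl opprB [RHS]addrC addrA subrK.
  rewrite memvB //; first by apply/mem_eigenimage; exists y.
  by rewrite kk; apply/mem_eigenimage; exists y.
by rewrite dim_orbit_plane dim_eigenimage.
Qed.

Lemma sigma3 u : sigma (sigma (sigma u)) = u.
Proof. by rewrite -[u]iota'K !sigma_iota twist3. Qed.

(* [sigma] acts on the quotient of the plane by [U] as a scalar [k]. *)
Lemma fixed_line_eigenimage (U : {vspace 'rV[K]_9}) :
  \dim U = 2 -> (U <= orbit_plane)%VS -> fixed sigma U ->
  exists2 k, k ^+ 3 = 1 & U = eigenimage k.
Proof.
move=> dU UP /eqP fU.
have sU y : y \in U -> sigma y \in U by move=> yU; rewrite -fU memv_img.
have : ~~ (orbit_plane <= U)%VS.
  by apply/negP => /dimvS; rewrite dU dim_orbit_plane.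
case/subvPn => u uP uU.
have u0 : u != 0 by apply: contraNneq uU => ->; rewrite mem0v.
have capU : (U :&: <[u]> = 0)%VS.
  apply/eqP; rewrite -subv0; apply/subvP => x /memv_capP[xU /vlineP[a xa]].
  have [a0|a0] := eqVneq a 0; first by rewrite xa a0 scale0r mem0v.
  by case/negP: uU; rewrite -[u](scalerK a0) -xa memvZ.
have PU : (U + <[u]>)%VS = orbit_plane.
  apply/eqP; rewrite eqEdim subv_add UP -memvE uP /=.
  by rewrite dimv_disjoint_sum // dU dim_vline u0 dim_orbit_plane.
have : sigma u \in (U + <[u]>)%VS by rewrite PU sigma_plane_mem.
case/memv_addP => x xU [_ /vlineP[k ->] su].
(* Since [sigma] has cube the identity, [(1 - k ^+ 3) *: u] lies in [U], whereas [u] does not. *)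
have k3 : k ^+ 3 = 1.
  apply/eqP/negPn/negP => nk; case/negP: uU.
  have nk' : 1 - k ^+ 3 != 0 by rewrite subr_eq0 eq_sym.
  rewrite -[u](scalerK nk') memvZ //.
  have s2 : sigma (sigma u) = sigma x + k *: x + k ^+ 2 *: u.
    by rewrite {1}su linearD linearZ /= su scalerDr scalerA addrA.
  have s3 : u = sigma (sigma x) + k *: sigma x + k ^+ 2 *: x + k ^+ 3 *: u.
    by rewrite -{1}[u]sigma3 s2 !linearD !linearZ /= su scalerDr scalerA -exprSr addrA.
  rewrite scalerBl scale1r {1}s3 addrK.
  by rewrite !memvD ?memvZ ?sU.
(* The map [sigma - k] sends both [U] and [u] into [U], and the dimensions agree. *)
exists k => //; apply/esym/eqP; rewrite eqEdim dU dim_eigenimage // leqnn andbT.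
apply/subvP => _ /mem_eigenimage[y + ->]; rewrite -PU.
case/memv_addP => z zU [_ /vlineP[m ->] ->].
have -> : sigma (z + m *: u) - k *: (z + m *: u) = sigma z + m *: x - k *: z.
  rewrite linearD linearZ /= su !scalerDr !scalerA [k * m]mulrC opprD !addrA.
  by rewrite addrAC addrK.
by rewrite memvB ?memvD ?memvZ ?sU.
Qed.

(** Without such a point every vector of the line would be an eigenvector, so [sigma] would be a
    scalar on it, against [eigenvector_line]. *)
Lemma fixed_line_is_II (l : line 'rV[K]_9) :
  (l <= orbit_plane)%VS -> fixed sigma l -> fixed_II_line iota phi sigma l.
Proof.
move=> lP fl; apply/andP; split=> //; apply: contraT => /existsPn noII.
have dl : \dim l = 2 by case: (l) => U /= /eqP.
have sl y : y \in flat_space l -> sigma y \in flat_space l.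
  by move=> yl; rewrite -(eqP fl) memv_img.
have eig u : u \in flat_space l -> u != 0 -> exists k, sigma u = k *: u.
  move=> ul u0; have [B Bu] := vector_point u0.
  have /mem_orbit_plane[[[a b] c] ut] := subvP lP _ ul.
  have t0 : (a, b, c) != (0, 0, 0).
    by apply: contra_neq u0 => t0; rewrite ut t0 iota_comb !scale0r !addr0.
  have := noII B; rewrite Bu -memvE ul andbT; rewrite ut in Bu.
  (* The orbit of [u] stays in [l], of dimension 2, hence is dependent. *)
  rewrite (II_collinear_comb t0 Bu) (_ : circ_det _ == 0) ?andbT; last first.
    apply/negPn; rewrite -iota_free_comb -free3E -ut -!sigma_iota -ut.
    apply/negP => fr; have : (\dim <<[:: u; sigma u; sigma (sigma u)]>> <= \dim l)%N.
      by apply/dimvS/span_subvP => y; rewrite !inE => /or3P[] /eqP->; rewrite ?sl.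
    by rewrite (eqP fr) dl.
  rewrite negbK => /existsP[k /eqP/= tk]; exists k.
  by rewrite ut sigma_iota twist_comb tk -combZ iotaZ.
have x0 : vpick l != 0 by rewrite vpick0 -dimv_eq0 dl.
have xl := memv_pick l; move: (vpick l) x0 xl => x x0 xl.
have : ~~ (l <= <[x]>)%VS by apply/negP => /dimvS; rewrite dl dim_vline x0.
case/subvPn => y yl yx.
have y0 : y != 0 by apply: contraNneq yx => ->; rewrite mem0v.
have xy0 : x + y != 0.
  apply: contraNneq yx => /eqP; rewrite addr_eq0 eq_sym eqr_oppLR => /eqP->.
  by rewrite memvN memv_line.
(* As [x] and [y] are independent, comparing them with [x + y] forces equal eigenvalues. *)
have [k sx] := eig x xl x0; have [m sy] := eig y yl y0.
have [p e0] := eig _ (memvD xl yl) xy0.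
have e : k *: x + m *: y = p *: x + p *: y by rewrite -scalerDr -e0 linearD /= sx sy.
have mp : m = p.
  apply/eqP/negPn/negP => mp; case/negP: yx.
  have nk : m - p != 0 by rewrite subr_eq0.
  rewrite -[y](scalerK nk) memvZ // scalerBl.
  have -> : m *: y - p *: y = (p - k) *: x.
    by apply/eqP; rewrite scalerBl subr_eq addrAC eq_sym subr_eq -e addrC.
  by rewrite memvZ ?memv_line.
have kp : k = p.
  move: e; rewrite mp => /addIr/eqP; rewrite -subr_eq0 -scalerBl scaler_eq0.
  by rewrite (negPf x0) orbF subr_eq0 => /eqP.
move: yx; rewrite mp -kp in sy.
rewrite (vline_eq x0 (eigenvector_line (subvP lP _ xl) sx)).
by rewrite (eigenvector_line (subvP lP _ yl) sy).
Qed.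

Lemma card_plane_II_lines :
  #|[set l : line 'rV[K]_9 | (l <= orbit_plane)%VS & fixed_II_line iota phi sigma l]| =
  gcdn 3 (#|K| - 1).
Proof.
rewrite -card_cube_roots1 -(card_in_imset eigenimage_inj).
rewrite -(card_imset _ (@flat_space_inj _ _ 1)); apply: eq_card => U.
apply/imsetP/imsetP => [[l + ->]|[k + ->]]; rewrite !inE.
  case/andP => lP /andP[fl _].
  have dl : \dim l = 2 by case: (l) => W /= /eqP.
  have [k k3 lk] := fixed_line_eigenimage dl lP fl.
  by exists k; rewrite // inE k3.
move=> /eqP k3; have dk : \dim (eigenimage k) == 2 by rewrite dim_eigenimage.
exists (Flat dk) => //; rewrite inE /= eigenimage_sub.
by apply: fixed_line_is_II; [apply: eigenimage_sub | apply: fixed_eigenimage].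
Qed.

End Plane.

(** * Counting the III-points and the fixed planes through them *)

Lemma fixed_plane_orbit (pi : plane 'rV[K]_9) v :
  fixed sigma pi -> iota v \in flat_space pi -> typeIII_vector v ->
  flat_space pi = orbit_plane v.
Proof.
move=> /eqP fpi vpi vIII; apply/esym/eqP; rewrite eqEdim dim_orbit_plane //.
have dpi : \dim pi = 3 by case: (pi) => U /= /eqP.
have spi y : y \in flat_space pi -> sigma y \in flat_space pi.
  by move=> ypi; rewrite -fpi memv_img.
rewrite dpi leqnn andbT; apply/span_subvP => y; rewrite !inE -!sigma_iota.
by case/or3P => /eqP->; rewrite ?spi.
Qed.

Lemma typeIII_vector_neq0 v : typeIII_vector v -> v != 0.
Proof.
apply: contraTneq => ->; apply/negP => /row_free3P/(_ 1 0 0).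
by rewrite scaler0 !scale0r !addr0 => /(_ erefl)[/eqP]; rewrite oner_eq0.
Qed.

Lemma fixed_III_planeP (pi : plane 'rV[K]_9) :
  reflect (exists2 v, typeIII_vector v & flat_space pi = orbit_plane v)
          (fixed_III_plane iota phi sigma pi).
Proof.
apply: (iffP andP) => [[fpi /existsP[B /andP[BIII Bpi]]]|[v vIII piv]].
  have [u u0 Bu] := point_vector B.
  have v0 : iota' u != 0 by rewrite -iota_eq0 iota'K.
  have Bv : flat_space B = <[iota (iota' u)]>%VS by rewrite iota'K.
  have vIII : typeIII_vector (iota' u) by rewrite -(III_pointE v0 Bv).
  exists (iota' u) => //; apply: fixed_plane_orbit => //.
  by rewrite memvE -Bv.
split; first by rewrite /fixed piv sigma_orbit_plane.
have v0 := typeIII_vector_neq0 vIII.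
have iv0 : iota v != 0 by rewrite iota_eq0.
have [B Bv] := vector_point iv0; apply/existsP; exists B.
by rewrite (III_pointE v0 Bv) vIII Bv piv -memvE memv_span ?mem_head.
Qed.

(** Double counting of incident pairs: by [fixed_plane_orbit] each III-point lies on exactly one of
    the planes. *)
Lemma card_III_incidence N :
  (forall v, typeIII_vector v ->
    #|[set B : point 'rV[K]_9 | (B <= orbit_plane v)%VS & III_point iota phi B]| = N) ->
  (#|[set pi : plane 'rV[K]_9 | fixed_III_plane iota phi sigma pi]| * N)%N =
  #|[set B : point 'rV[K]_9 | III_point iota phi B]|.
Proof.
move=> cN; rewrite -sum_nat_const.
transitivity (\sum_(pi in [set pi : plane 'rV[K]_9 | fixed_III_plane iota phi sigma pi])
   \sum_(B : point 'rV[K]_9 |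
     (flat_space B <= flat_space pi)%VS && III_point iota phi B) 1)%N.
  apply: eq_bigr => pi; rewrite inE => /fixed_III_planeP[v vIII piv].
  by rewrite sum1dep_card piv cN.
rewrite (exchange_big_dep (fun B => III_point iota phi B)) /=; last first.
  by move=> pi B _ /andP[].
rewrite -sum1dep_card; apply: eq_bigr => B BIII.
have [u u0 Bu] := point_vector B.
have v0 : iota' u != 0 by rewrite -iota_eq0 iota'K.
have Bv : flat_space B = <[iota (iota' u)]>%VS by rewrite iota'K.
have vIII : typeIII_vector (iota' u) by rewrite -(III_pointE v0 Bv).
have dv : \dim (orbit_plane (iota' u)) == 3 by rewrite dim_orbit_plane.
rewrite sum1dep_card (_ : [set _ | _] = [set Flat dv]) ?cards1 //.
apply/setP => pi; rewrite !inE BIII andbT; apply/andP/eqP => [[/andP[fpi _] Bpi]|->].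
  apply: flat_space_inj; apply: fixed_plane_orbit => //.
  by rewrite memvE -Bv.
split; first by apply/fixed_III_planeP; exists (iota' u).
by rewrite Bv /= -memvE memv_span ?mem_head.
Qed.

Lemma card_typeIII_vectors : #|L| = (#|K| ^ 3)%N ->
  #|[set v | typeIII_vector v]| =
  (#|K| ^ 3 * ((#|K| - 1) * (#|K| ^ 2 - 1) * (#|K| ^ 3 - 1)))%N.
Proof.
move=> cardL; have [tau [sE tauf tau3 [b tb]]] := twist_coordinates.
have tau_inj : injective tau by apply: fmorph_inj.
pose x0 : 'rV[L]_3 := row3 (1, b, b ^+ 2).
(* The rows are the orbit of [x *m E] in the coordinates given by [E]. *)
pose M (x : 'rV[L]_3) : 'M[L]_3 := mx3 x (map_mx tau x) (map_mx tau (map_mx tau x)).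
have III_M x : typeIII_vector (x *m E) = (M x \in unitmx).
  rewrite /typeIII_vector !sE -row_free_unit /row_free.
  rewrite (_ : mx3 _ _ _ = M x *m E) ?mxrankMfree ?row_free_unit //.
  by apply/row_matrixP => i; rewrite row_mul !rowK; case: i => [[|[|[|//]]] i3].
have x0_unit : M x0 \in unitmx.
  rewrite -unitmx_tr unitmxE unitfE.
  (* The three nodes are distinct because [tau b != b] and [tau] has cube the identity. *)
  rewrite (_ : (M x0)^T = Vandermonde 3 (row3 (b, tau b, tau (tau b)))).
    have ttb : tau (tau b) != b by rewrite -(inj_eq tau_inj) tau3 eq_sym.
    rewrite det_Vandermonde; apply/prodf_neq0 => i _; apply/prodf_neq0 => j.
    rewrite subr_eq0 !mxE.
    by case: i => [[|[|[|//]]] i3]; case: j => [[|[|[|//]]] j3] //= _;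
      rewrite ?(inj_eq tau_inj).
  apply/matrixP => i j; rewrite !mxE.
  by case: i => [[|[|[|//]]] i3]; case: j => [[|[|[|//]]] j3];
    rewrite /= !mxE /= ?mxE /= ?expr0 ?expr1 ?rmorph1 ?rmorphXn.
pose h (A : 'M[K]_3) := x0 *m map_mx f A *m E.
(* The entries of [map_mx f A] are fixed by [tau], so this factor comes out of all three rows. *)
have M_h A : M (x0 *m map_mx f A) = M x0 *m map_mx f A.
  have tA : map_mx tau (map_mx f A) = map_mx f A.
    by apply/matrixP => i j; rewrite !mxE tauf.
  rewrite /M !map_mxM /= !tA; apply/row_matrixP => i; rewrite row_mul !rowK.
  by case: i => [[|[|[|//]]] i3].
have h_inj : injective h.
  move=> A B /(can_inj (mulmxK E_unit)) AB.
  have : M x0 *m map_mx f A = M x0 *m map_mx f B by rewrite -!M_h AB.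
  by move/(can_inj (mulKmx x0_unit))/map_mx_inj.
(* Both sides have [#|K| ^ 9] elements; this is where the degree of L over K enters. *)
have h_bij : bijective h.
  by apply: inj_card_bij => //; rewrite !card_mx cardL -expnM.
transitivity #|[set A : 'M[K]_3 | A \in unitmx]|.
  rewrite -(on_card_preimset (onW_bij _ h_bij)); apply: eq_card => A.
  by rewrite !inE III_M M_h unitmx_mul x0_unit map_unitmx.
transitivity #|'GL_3[K]%G|.
  rewrite -[RHS](card_imset _ val_inj); apply: eq_card => A; rewrite inE.
  apply/idP/imsetP => [uA|[x _ ->]]; last exact: (valP x).
  by exists (Sub A uA); rewrite ?inE ?SubK.
rewrite card_GL //; move: #|K| => k.
by rewrite 3?big_ltn // big_geq // muln1 expn1 !mulnA.
Qed.

Lemma card_III_points : #|L| = (#|K| ^ 3)%N ->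
  #|[set B : point 'rV[K]_9 | III_point iota phi B]| =
  (#|K| ^ 3 * ((#|K| ^ 2 - 1) * (#|K| ^ 3 - 1)))%N.
Proof.
move=> cardL.
have q1 : (0 < #|K|.-1)%N by have := finNzRing_gt1 K; case: #|K| => // -[].
apply/eqP; rewrite -(eqn_pmul2r q1).
rewrite (card_points (R := fun u => typeIII_vector (iota' u))); last first.
  by move=> B u u0 Bu; apply: III_pointE; rewrite ?iota'K // -iota_eq0 iota'K.
rewrite -(card_imset _ (can_inj iota'K)).
rewrite (_ : [set _ | _ in _] = [set v | typeIII_vector v]).
  by rewrite card_typeIII_vectors // {1}subn1 -(mulnA #|K|.-1) mulnCA mulnC.
apply/setP => v; rewrite [RHS]inE; apply/imsetP/idP => [[u + ->]|vIII].
  by rewrite inE => /andP[].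
exists (iota v); rewrite ?iotaK // inE iotaK vIII andbT iota_eq0.
exact: typeIII_vector_neq0.
Qed.

(** The value is [q ^ 2], [q.-1 ^ 2] or [(q ^ 2).-1] for [n] equal to 0, 1 or -1: the number of
    triples with nonzero determinant divided by [q.-1]. *)
Lemma card_plane_III_value (q g : nat) (n : int) :
  #|K| = q -> n \in [:: -1; 0; 1] -> (q%:Z = n %[mod 3])%Z ->
  g = gcdn 3 (q - 1) ->
  exists N : nat, [/\ (0 < N)%N,
    N%:Z = q%:Z ^+ 2 + q%:Z + 1 - g%:Z * (q%:Z - n + 1)
  & forall v, typeIII_vector v ->
    #|[set B : point 'rV[K]_9 | (B <= orbit_plane v)%VS & III_point iota phi B]| = N].
Proof.
move=> cardK n_val n_mod g_def; have := finNzRing_gt1 K; rewrite cardK => q_gt1.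
have q1 : (0 < q.-1)%N by case: (q) q_gt1 => [|[]].
have from_count N : (N * q.-1)%N = #|[set t : K * K * K | circ_det t != 0]| ->
    forall v, typeIII_vector v ->
    #|[set B : point 'rV[K]_9 | (B <= orbit_plane v)%VS & III_point iota phi B]| = N.
  move=> cN v vIII; apply/eqP; rewrite -(eqn_pmul2r q1) cN -cardK.
  by rewrite card_plane_III.
have [d0|[d1|d2]] : (3 %| q)%N \/ (3 %| q.-1)%N \/ (3 %| q.+1)%N by lia.
- have g1 : g = 1%N.
    rewrite g_def; apply/eqP; rewrite -/(coprime _ _) prime_coprime //.
    by apply/negP; lia.
  have n0 : n = 0.
    move: n_val n_mod; rewrite !inE => /or3P[] /eqP-> //; lia.
  exists (q ^ 2)%N; split; [by rewrite expn_gt0; lia | by rewrite g1 n0; lia |].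
  by apply: from_count; rewrite card_circ_det_mod0 cardK.
- have g3 : g = 3%N by rewrite g_def subn1; apply/gcdn_idPl.
  have n1 : n = 1.
    move: n_val n_mod; rewrite !inE => /or3P[] /eqP-> //; lia.
  exists (q.-1 ^ 2)%N; split; first by rewrite expn_gt0 q1.
    by rewrite g3 n1; case: (q) q_gt1 => // k _ /=; rewrite -mulnn PoszM; lia.
  by apply: from_count; rewrite card_circ_det_mod1 cardK // -expnSr.
have g1 : g = 1%N.
  rewrite g_def; apply/eqP; rewrite -/(coprime _ _) prime_coprime //.
  by apply/negP; lia.
have n1 : n = -1.
  move: n_val n_mod; rewrite !inE => /or3P[] /eqP-> //; lia.
have q2 : (1 < q ^ 2)%N by rewrite -{1}(exp1n 2) ltn_exp2r.
exists (q ^ 2).-1; split; first by case: (q ^ 2)%N q2 => [|[]].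
  by rewrite g1 n1; lia.
by apply: from_count; rewrite card_circ_det_mod2 cardK // mulnC.
Qed.

End Bose.

(** * The number of fixed planes and the content of each *)

Theorem theorem20 (q g : nat) (n : int) (K L : finFieldType)
    (f : {rmorphism K -> L}) (E : 'M[L]_3)
    (phi : point 'rV[L]_3 -> point 'rV[L]_3)
    (iota : 'rV[L]_3 -> 'rV[K]_9) (sigma : 'End('rV[K]_9))
    (q_gt2 : (2 < q)%N)
    (cardK : #|K| = q) (cardL : #|L| = (q ^ 3)%N)
    (n_val : n \in [:: -1; 0; 1]) (n_mod : (q%:Z = n %[mod 3])%Z)
    (g_def : g = gcdn 3 (q - 1))
    (E_unit : E \in unitmx)
    (phi_coll : collineation phi) (phi_order : has_order3 phi)
    (phi_fix : forall P, P \in subplane f E -> phi P = P)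
    (iota_id : identification f iota)
    (sigma_ind : induced_by iota E phi sigma) :
  #|[set pi : plane 'rV[K]_9 | fixed_III_plane iota phi sigma pi]|%:Q =
    (q%:Q ^+ 3 * (q%:Q ^+ 2 - 1) * (q%:Q - 1) * (q%:Q ^+ 2 + q%:Q + 1)) /
    (q%:Q ^+ 2 + q%:Q + 1 - g%:Q * (q%:Q - n%:Q + 1))
  /\
  forall pi : plane 'rV[K]_9, fixed_III_plane iota phi sigma pi ->
    [/\ #|[set B : point 'rV[K]_9 | (B <= pi)%VS & fixed sigma B]| = g,
        #|[set B : point 'rV[K]_9 | (B <= pi)%VS &
            II_collinear_point iota phi sigma B]|%:Z = g%:Z * (q%:Z - n),
        #|[set B : point 'rV[K]_9 | (B <= pi)%VS & III_point iota phi B]|%:Z =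
          q%:Z ^+ 2 + q%:Z + 1 - g%:Z * (q%:Z - n + 1)
      & #|[set l : line 'rV[K]_9 | (l <= pi)%VS &
            fixed_II_line iota phi sigma l]| = g].
Proof.
have [[iota' iotaK iota'K] iota_lin] := iota_id.
have cardL' : #|L| = (#|K| ^ 3)%N by rewrite cardK.
have q_gt1 : (1 < q)%N by apply: ltnW.
have q1 : (0 < q.-1)%N by case: (q) q_gt1 => [|[]].
have [N [N_gt0 NZ cN]] := card_plane_III_value E_unit phi_order iotaK iota'K
  iota_lin sigma_ind cardK n_val n_mod g_def.
split.
  (* The denominator is the number of III-points on a plane, hence nonzero. *)
  have NQ : q%:Q ^+ 2 + q%:Q + 1 - g%:Q * (q%:Q - n%:Q + 1) = N%:Q.
    by rewrite NZ rmorphB !rmorphD rmorphXn rmorphM rmorphD rmorphB.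
  have N0 : N%:Q != 0 by rewrite intr_eq0; case: (N) N_gt0.
  rewrite NQ; apply: (canRL (mulfK N0)); rewrite -intrM -PoszM.
  rewrite (card_III_incidence E_unit phi_order iotaK iota'K iota_lin sigma_ind cN).
  rewrite (card_III_points E_unit phi_order iotaK iota'K iota_lin sigma_ind cardL').
  (* With [q = k.+1] the truncated subtractions become products. *)
  rewrite cardK; case: (q) q_gt1 => // k _.
  have -> : (k.+1 ^ 2 - 1 = k * k.+2)%N by lia.
  have -> : (k.+1 ^ 3 - 1 = k * (k.+1 ^ 2 + k.+1 + 1))%N by lia.
  rewrite -!pmulrn !(natrM, natrX, natrD) -(natr1 k.+1) -(natr1 k); ring.
move=> pi /(fixed_III_planeP E_unit phi_order iotaK iota'K iota_lin sigma_ind)[v vIII ->].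
have cIII := cN v vIII.
have cfix := card_plane_fixed E_unit phi_order iotaK iota'K iota_lin sigma_ind vIII.
have clines := card_plane_II_lines E_unit phi_order iotaK iota'K iota_lin sigma_ind vIII.
have ctot := card_plane_total iotaK iota_lin vIII.
have cII := card_plane_partition E_unit phi_order iotaK iota'K iota_lin sigma_ind vIII.
rewrite cardK -g_def in cfix clines; rewrite cardK in ctot.
have {}ctot : #|[set B : point 'rV[K]_9 | (B <= orbit_plane iota iota' sigma v)%VS]|
    = (q ^ 2 + q + 1)%N.
  apply/eqP; rewrite -(eqn_pmul2r q1) ctot; case: (q) q_gt1 => // k _ /=.
  by apply/eqP; lia.
split=> //; last by rewrite cIII NZ.
rewrite ctot cIII cfix in cII.
(* Removing III-points and fixed points leaves [g * (q - n + 1) - g], that is, [g * (q - n)]. *)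
have := congr1 Posz cII; rewrite !PoszD NZ => e; lia.
Qed.
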